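(* Let $k$ be a field, $n>0$, $X=\{x_0,\dots,x_n\}$ and $Y=\{y_0,\dots,y_n\}$. Let $T$ be the universal localization of $k\langle X\rangle$ with respect to the set $\Sigma_1=\Sigma'_k(x_0,\dots,x_n)\cup\{(x_0,\dots,x_n)^T\}$. Let $Q$ be the universal localization of $R=k\langle Y\rangle$ with respect to the set $\Sigma$ of all monomorphisms between finitely generated projective right $R$-modules whose images have finite codimension. Then there is a unique $k$-algebra isomorphism $\psi:Q\to T$ which is the identity on $R$.
   Context: $k\langle X\rangle$, $k\langle Y\rangle$ are free $k$-algebras. $\Sigma'_k(x_0,\dots,x_n)$ is the set of all square matrices over $k\langle X\rangle$ of the form $A_0+B$, where $A_0$ is an invertible matrix over $k$ and all entries of $B$ are noncommutative polynomials in $x_0,\dots,x_n$ with zero constant term. The column $(x_0,\dots,x_n)^T$ is viewed as a right module map $k\langle X\rangle\to k\langle X\rangle^{n+1}$, and matrices as maps between free right modules. The universal localization $A\to A_\Sigma$ of a ring $A$ with respect to a set $\Sigma$ of maps between finitely generated projective right $A$-modules is the universal ring homomorphism from $A$ making all maps of $\Sigma$ invertible. In $T$, the column $(x_0,\dots,x_n)^T$ has an inverse row, denoted $(y_0,\dots,y_n)$, so that $x_iy_j=\delta_{ij}$ and $\sum_i y_ix_i=1$; the $k$-algebra map $R=k\langle Y\rangle\to T$ sending each $y_j$ to this element $y_j\in T$ is injective, and $R$ is identified with its image in $T$. The canonical map $R\to Q$ is also injective and $R$ is identified with its image in $Q$. Codimension means $k$-dimension of the quotient. *)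

(* Defs.v *)
From HB Require Import structures.
From mathcomp Require Import all_boot all_order all_algebra.
From mathcomp Require Import monalg.

Set Implicit Arguments.
Unset Strict Implicit.
Unset Printing Implicit Defensive.

Import GRing.Theory.
Local Open Scope ring_scope.

(* A right A-module is a left module over the converse ring A^c, so that
   [(a : A^c) *: p] stands for the right action p . a.  Rings may be zero
   (pzRingType), since a universal localization may be. *)
Notation rmodType A := (lmodType A^c).

Section MatrixMap.
Context (A : pzRingType) (m n : nat) (M : 'M[A]_(m, n)).

(* The free right module A^n is 'cV[A^c]_n.  The product below is computed in A,
   not in A^c: M acts on columns on the left. *)
Definition mx_map (v : 'cV[A^c]_n) : 'cV[A^c]_m := M *m (v : 'cV[A]_n).

Fact mx_map_linear : linear mx_map.
Proof.
move=> a u v; apply/matrixP=> i j; rewrite !mxE.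
rewrite -[a * _]/((\sum_l M i l * (u l j : A)) * (a : A)).
rewrite mulr_suml -big_split /=.
by apply: eq_bigr => l _; rewrite !mxE mulrDr mulrA.
Qed.

HB.instance Definition _ :=
  GRing.isLinear.Build A^c 'cV[A^c]_n 'cV[A^c]_m *:%R mx_map mx_map_linear.

End MatrixMap.

Section FinitelyGeneratedProjective.
Context (A : pzRingType).

Definition finitely_generated (P : rmodType A) : Prop :=
  exists (d : nat) (e : 'I_d -> P),
    forall p : P, exists a : 'I_d -> A^c, p = \sum_(i < d) a i *: e i.

Definition projective (P : rmodType A) : Prop :=
  forall (M N : rmodType A) (g : {linear M -> N}) (h : {linear P -> N}),
    (forall y : N, exists x : M, g x = y) ->
    exists l : {linear P -> M}, forall p : P, g (l p) = h p.

Definition morphism_set : Type :=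
  forall P P' : rmodType A, {linear P -> P'} -> Prop.

End FinitelyGeneratedProjective.

Section UniversalLocalization.
Context (A : pzRingType).

Definition semilinear_along (B : pzRingType) (f : {rmorphism A -> B})
    (P : rmodType A) (N : rmodType B) (u : P -> N) : Prop :=
  (forall p q : P, u (p + q) = u p + u q) /\
  (forall (a : A) (p : P), u ((a : A^c) *: p) = (f a : B^c) *: u p).

(* u : P -> PB exhibits PB as the extension of scalars P (x)_A B along f. *)
Definition is_base_change (B : pzRingType) (f : {rmorphism A -> B})
    (P : rmodType A) (PB : rmodType B) (u : P -> PB) : Prop :=
  semilinear_along f u /\
  forall (N : rmodType B) (g : P -> N), semilinear_along f g ->
    exists h : {linear PB -> N}, (forall p : P, h (u p) = g p) /\
      forall h' : {linear PB -> N}, (forall p : P, h' (u p) = g p) -> h' =1 h.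

(* alpha (x)_A B is an isomorphism; base changes being unique up to a unique
   isomorphism, the choice of PB and PB' is immaterial. *)
Definition makes_invertible (B : pzRingType) (f : {rmorphism A -> B})
    (P P' : rmodType A) (alpha : {linear P -> P'}) : Prop :=
  forall (PB PB' : rmodType B) (u : P -> PB) (u' : P' -> PB')
    (alphaB : {linear PB -> PB'}),
    is_base_change f u -> is_base_change f u' ->
    (forall p : P, alphaB (u p) = u' (alpha p)) ->
    bijective alphaB.

Definition inverting (S : morphism_set A) (B : pzRingType)
    (f : {rmorphism A -> B}) : Prop :=
  forall (P P' : rmodType A) (alpha : {linear P -> P'}),
    S P P' alpha -> makes_invertible f alpha.

Definition is_universal_localization (S : morphism_set A)
    (AS : pzRingType) (iota : {rmorphism A -> AS}) : Prop :=
  inverting S iota /\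
  forall (B : pzRingType) (f : {rmorphism A -> B}), inverting S f ->
    exists g : {rmorphism AS -> B}, (forall a : A, g (iota a) = f a) /\
      forall g' : {rmorphism AS -> B}, (forall a : A, g' (iota a) = f a) ->
        g' =1 g.

End UniversalLocalization.

(* The free algebra on N = n.+1 generators is the monoid algebra of the free
   monoid on 'I_N. *)
Notation free_alg k N := {malg k[{fmonom 'I_N}]}.

Section FreeAlgebra.
Context (k : fieldType) (N : nat).

Definition gen (i : 'I_N) : free_alg k N := << fmu i >>.

Definition const_coef (p : free_alg k N) : k := p@_mone.

Definition Sigma_prime (m : nat) (M : 'M[free_alg k N]_m) : Prop :=
  exists (A0 : 'M[k]_m) (B : 'M[free_alg k N]_m),
    [/\ A0 \in unitmx,
        forall i j, const_coef (B i j) = 0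
      & M = map_mx (fun c : k => c%:A) A0 + B].

Definition gen_col : 'cV[free_alg k N]_N := \col_(i < N) gen i.

Inductive Sigma1 : morphism_set (free_alg k N) :=
| Sigma1_square m (M : 'M[free_alg k N]_m) :
    Sigma_prime M -> Sigma1 (mx_map M)
| Sigma1_col : Sigma1 (mx_map gen_col).

(* dim_k (P' / alpha(P)) < oo: finitely many vectors span P' modulo the image
   of alpha. *)
Definition image_finite_codim (P P' : rmodType (free_alg k N))
    (alpha : {linear P -> P'}) : Prop :=
  exists (d : nat) (v : 'I_d -> P'), forall p' : P',
    exists (c : 'I_d -> k) (p : P),
      p' = \sum_(i < d) ((c i)%:A : (free_alg k N)^c) *: v i + alpha p.

Definition Sigma_codim : morphism_set (free_alg k N) :=
  fun P P' alpha =>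
    [/\ finitely_generated P /\ projective P,
        finitely_generated P' /\ projective P',
        injective alpha
      & image_finite_codim alpha].

End FreeAlgebra.

(* Main.v *)
Require Import Defs.
From Stdlib Require Import ClassicalEpsilon.
From HB Require Import structures.
From mathcomp Require Import all_boot all_order all_algebra.
From mathcomp Require Import finmap monalg.

Set Implicit Arguments.
Unset Strict Implicit.
Unset Printing Implicit Defensive.

Import GRing.Theory.
Local Open Scope ring_scope.

(** Each of the two rings inverts the maps that define the other one. In both,
    the row (y_j) has an inverse column (x_i), which turns R-linear data into
    data over k<X> and back. The two universal properties therefore give
    homomorphisms Q -> T and T -> Q that match the y_j and the x_i. Each
    composite fixes the image of the algebra that its ring localizes, so that
    it is the identity. The work lies in the first assertion.

    T inverts the maps of finite codimension ([inverts_Sigma_codim]). Let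
    alpha : P -> P' be injective with finite-dimensional cokernel C, and let V
    be a T-module. It is enough that every semilinear map P -> V extends
    uniquely along alpha ([makes_invertible_of_extension]), that is, Hom (C,
    V) = 0 and Ext^1 (C, V) = 0 over R. Choose a basis v of P' modulo the
    image, on which y_i acts by a matrix D_i over k modulo the image. The
    values z = g (v) of an extension g are subject to z y_i = z D_i + b_i with
    known b_i, and as x is inverse to y this is equivalent to z (1 - sum_i x_i
    D_i) = sum_i b_i x_i ([systemP]). The matrix 1 - sum_i x_i D_i belongs to
    Sigma', hence is invertible over T, and there is exactly one such z.

    Q inverts Sigma_1 ([dual_eval_inverts_Sigma1]). For matrices C_i over k
    the row of blocks y_i + C_i is the standard resolution of a
    finite-dimensional module: it is injective, because its columns have
    independent leading forms, and constant columns span its cokernel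
    ([resolution_mx_Sigma_codim]). So it belongs to Sigma. With C = 0 this
    makes the row (y_j) invertible over Q and defines the x_i. In general, the
    factorization 1 + sum_i x_i C_i = (y_i + C_i)_i (x_i)_i shows that
    matrices of degree one over k<X> with invertible constant part become
    invertible, and Higman linearization reduces all of Sigma' to degree one
    ([deg_le_invertible]). *)

(** * Invertible matrices over a ring *)

Section InvertibleMatrix.
Context (S : pzRingType).

(** The shape need not be square: over the localizations at stake a row of
    length n.+1 has a two-sided inverse. *)
Definition mx_invertible m n (M : 'M[S]_(m, n)) : Prop :=
  exists M' : 'M[S]_(n, m), M *m M' = 1%:M /\ M' *m M = 1%:M.

Lemma mx_invertibleM m n p (M : 'M[S]_(m, n)) (M1 : 'M[S]_(n, p)) :
  mx_invertible M -> mx_invertible M1 -> mx_invertible (M *m M1).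
Proof.
move=> [M' [MM' M'M]] [M1' [MM1' M1'M]]; exists (M1' *m M').
by rewrite !mulmxA -(mulmxA M) MM1' -(mulmxA M1') M'M !mulmx1.
Qed.

(** The identity block clears the rest of its block row and of its block
    column by elementary operations, which leaves the Schur complement D + X
    C. In the reverse direction this is a linearization: it trades the product
    X C for a larger matrix in which X and C are separate entries. *)
Lemma mx_invertible_schur m p (C : 'M[S]_(p, m)) (X : 'M[S]_(m, p))
    (D : 'M[S]_m) :
  mx_invertible (block_mx 1%:M C (- X) D) -> mx_invertible (D + X *m C).
Proof.
move=> [U']; rewrite -[U']submxK; set a := ulsubmx U'; set b := ursubmx U'.
set c := dlsubmx U'; set d := drsubmx U' => -[].
rewrite !mulmx_block !scalar_mx_block !mul1mx !mulmx1.
move=> /eq_block_mx[_ bCd _ Xb] /eq_block_mx[_ _ cdX cCd].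
have {bCd} bE : b = - (C *m d) by apply/eqP; rewrite -addr_eq0 bCd.
have {cdX} cE : c = d *m X.
  by apply/eqP; rewrite -subr_eq0 -mulmxN cdX.
exists d; split.
  by rewrite mulmxDl -mulmxA -Xb bE mulmxN mulNmx opprK addrC.
by rewrite mulmxDr mulmxA -cE addrC.
Qed.

End InvertibleMatrix.

(** * Maps inverted by a ring homomorphism *)

Section Semilinear.
Context (A B : pzRingType) (f : {rmorphism A -> B}).

Section Maps.
Context (P : rmodType A) (N : rmodType B) (u : P -> N).
Hypothesis su : semilinear_along f u.

Lemma semilinear0 : u 0 = 0.
Proof. by apply: (addrI (u 0)); rewrite -su.1 !addr0. Qed.

Lemma semilinear_sum (I : Type) (r : seq I) (a : I -> A) (p : I -> P) :
  u (\sum_(i <- r) (a i : A^c) *: p i) =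
  \sum_(i <- r) (f (a i) : B^c) *: u (p i).
Proof.
elim: r => [|i r IHr]; first by rewrite !big_nil semilinear0.
by rewrite !big_cons su.1 su.2 IHr.
Qed.

Lemma semilinear_comp (N' : rmodType B) (g : {linear N -> N'}) :
  semilinear_along f (g \o u).
Proof.
by split=> [p q|a p] /=; rewrite ?su.1 ?linearD // su.2 linearZ.
Qed.

End Maps.

Lemma base_change_ext (P : rmodType A) (PB N : rmodType B) (u : P -> PB)
    (h1 h2 : {linear PB -> N}) :
  is_base_change f u -> (forall p, h1 (u p) = h2 (u p)) -> h1 =1 h2.
Proof.
move=> [su bu] h12; have [h [_ uh]] := bu _ _ (semilinear_comp su h2).
by move=> x; rewrite (uh h1) ?(uh h2).
Qed.

(** An R-module map alpha is inverted by f as soon as Hom (alpha, N) is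
    bijective for each module N over the target ring: by adjunction this is
    Yoneda for alpha (x) B. For injective alpha with projective target, the
    two hypotheses say that Ext^1 and Hom from coker alpha to N vanish. *)
Lemma makes_invertible_of_extension (P P' : rmodType A)
    (alpha : {linear P -> P'}) :
  (forall (N : rmodType B) (h : P -> N), semilinear_along f h ->
     exists g : P' -> N, semilinear_along f g /\ forall p, g (alpha p) = h p) ->
  (forall (N : rmodType B) (g1 g2 : P' -> N),
     semilinear_along f g1 -> semilinear_along f g2 ->
     (forall p, g1 (alpha p) = g2 (alpha p)) -> g1 =1 g2) ->
  makes_invertible f alpha.
Proof.
move=> ext uniq PB PB' u u' aB bu bu' com.
have [g [sg galpha]] := ext PB u bu.1.
have [beta [betaE _]] := bu'.2 PB g sg.
exists beta => x.
  apply: (base_change_ext (h1 := beta \o aB) (h2 := idfun) bu) => p /=.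
  by rewrite com betaE galpha.
apply: (base_change_ext (h1 := aB \o beta) (h2 := idfun) bu') => p /=.
rewrite betaE; move: p; apply: uniq.
- exact: semilinear_comp.
- exact: bu'.1.
- by move=> p; rewrite galpha com.
Qed.

Definition basis_vec (C : pzRingType) n (j : 'I_n) : 'cV[C^c]_n := delta_mx j 0.

Lemma cV_sum_basis (C : pzRingType) n (v : 'cV[C^c]_n) :
  v = \sum_j v j 0 *: basis_vec C j.
Proof.
rewrite [LHS]matrix_sum_delta; apply: eq_bigr => j _.
by rewrite big_ord_recl big_ord0 addr0.
Qed.

Lemma map_cV_semilinear n :
  semilinear_along f (fun v : 'cV[A^c]_n => map_mx f v : 'cV[B^c]_n).
Proof.
split=> [p q|a p]; apply/matrixP=> i j; rewrite !mxE ?rmorphD //.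
exact: (rmorphM f (p i j) a).
Qed.

Lemma map_basis_vec n (j : 'I_n) : map_mx f (basis_vec A j) = basis_vec B j.
Proof. by apply/matrixP=> a b; rewrite !mxE -[LHS]/(f (_%:R)) rmorph_nat. Qed.

Lemma cV_base_change n :
  is_base_change f (fun v : 'cV[A^c]_n => map_mx f v : 'cV[B^c]_n).
Proof.
split=> [|N g sg]; first exact: map_cV_semilinear.
pose h (w : 'cV[B^c]_n) : N := \sum_j w j 0 *: g (basis_vec A j).
have hlin : linear h.
  move=> a v w; rewrite /h scaler_sumr -big_split; apply: eq_bigr => j _ /=.
  by rewrite !mxE scalerDl scalerA.
pose hL : {linear 'cV[B^c]_n -> N} :=
  HB.pack h (GRing.isLinear.Build B^c 'cV[B^c]_n N *:%R h hlin).
exists hL; split=> [p|h' h'E w].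
  rewrite [in RHS](cV_sum_basis p) (semilinear_sum sg).
  by apply: eq_bigr => j _; rewrite !mxE.
rewrite [in LHS](cV_sum_basis w) linear_sum; apply: eq_bigr => j _.
by rewrite linearZ /= -h'E -map_basis_vec.
Qed.

Lemma mx_invertible_of_makes_invertible m n (M : 'M[A]_(m, n)) :
  makes_invertible f (mx_map M) -> mx_invertible (map_mx f M).
Proof.
move=> /(_ _ _ _ _ (mx_map (map_mx f M))
  (@cV_base_change n) (@cV_base_change m)).
case=> [p|g gK Kg]; first exact: (esym (map_mxM f M p)).
pose M' : 'M[B]_(n, m) := \matrix_(i, j) g (basis_vec B j) i 0.
have MM' : map_mx f M *m M' = 1%:M.
  apply/matrixP=> i j; have /matrixP/(_ i 0) := Kg (basis_vec B j).
  by rewrite !mxE eqxx andbT => <-; apply: eq_bigr => l _; rewrite !mxE.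
exists M'; split=> //; apply/matrixP=> i j.
have inj : forall v w : 'cV[B]_n, map_mx f M *m v = map_mx f M *m w -> v = w.
  by move=> v w vw; rewrite -[v]gK /= /mx_map vw -[RHS]gK.
suff /matrixP/(_ i 0) : col j (M' *m map_mx f M) = col j 1%:M.
  by rewrite mxE [X in _ = X -> _]mxE.
by apply: inj; rewrite !colE !mulmxA MM' mul1mx mulmx1.
Qed.

Lemma makes_invertible_of_mx_invertible m n (M : 'M[A]_(m, n)) :
  mx_invertible (map_mx f M) -> makes_invertible f (mx_map M).
Proof.
move=> [M' [MM' M'M]]; apply: makes_invertible_of_extension.
  move=> N h sh; pose g (w : 'cV[A^c]_m) : N :=
    \sum_j ((M' *m map_mx f w) j 0 : B^c) *: h (basis_vec A j).
  exists g; split=> [|v]; last first.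
    rewrite /g [in RHS](cV_sum_basis v) (semilinear_sum sh).
    apply: eq_bigr => j _; rewrite /mx_map.
    by rewrite map_mxM mulmxA M'M mul1mx mxE.
  split=> [v w|a v]; rewrite /g.
    rewrite -big_split; apply: eq_bigr => j _ /=.
    by rewrite (map_cV_semilinear m).1 mulmxDr mxE scalerDl.
  rewrite scaler_sumr; apply: eq_bigr => j _.
  rewrite (map_cV_semilinear m).2 scalerA; congr (_ *: _).
  have := linearZZ (mx_map M') (f a : B^c) (map_mx f v).
  by move=> /matrixP/(_ j 0); rewrite [X in _ = X -> _]mxE.
move=> N g1 g2 s1 s2 g12 v.
have gE (g : 'cV[A^c]_m -> N) (sg : semilinear_along f g) l :
    g (basis_vec A l) =
    \sum_j (M' j l : B^c) *: g (mx_map M (basis_vec A j)).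
  under eq_bigr => j _.
    rewrite [mx_map _ _]cV_sum_basis (semilinear_sum sg) scaler_sumr.
    under eq_bigr => i _ do rewrite scalerA.
    over.
  rewrite exchange_big /=; under eq_bigr => i _.
    rewrite -scaler_suml.
    have -> : \sum_j (M' j l : B^c) * f (mx_map M (basis_vec A j) i 0) =
        (i == l)%:R.
      have /matrixP/(_ i l) := MM'; rewrite !mxE => <-.
      by apply: eq_bigr => j _; rewrite /mx_map -colE !mxE.
    over.
  rewrite (bigD1 l) //= eqxx scale1r big1 ?addr0 // => i /negPf->.
  exact: scale0r.
rewrite (cV_sum_basis v) (semilinear_sum s1) (semilinear_sum s2).
apply: eq_bigr => i _; congr (_ *: _); rewrite !gE //.
by apply: eq_bigr => j _; rewrite g12.
Qed.

End Semilinear.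

Section FreeModule.
Context (A : pzRingType) (n : nat).

Lemma cV_finitely_generated : finitely_generated 'cV[A^c]_n.
Proof.
exists n, (@basis_vec A n) => p; exists (fun j => p j 0).
exact: cV_sum_basis.
Qed.

Lemma cV_projective : projective 'cV[A^c]_n.
Proof.
move=> M N g h gsurj.
have [s sE] : exists s : 'I_n -> M, forall j, g (s j) = h (basis_vec A j).
  have: forall j : 'I_n, exists x, g x = h (basis_vec A j).
    by move=> j; apply: gsurj.
  by case/fin_all_exists => s sE; exists s.
pose l (w : 'cV[A^c]_n) : M := \sum_j w j 0 *: s j.
have llin : linear l.
  move=> a v w; rewrite /l scaler_sumr -big_split; apply: eq_bigr => j _ /=.
  by rewrite !mxE scalerDl scalerA.
pose lL : {linear 'cV[A^c]_n -> M} :=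
  HB.pack l (GRing.isLinear.Build A^c 'cV[A^c]_n M *:%R l llin).
exists lL => p; rewrite [in RHS](cV_sum_basis p) !linear_sum.
by apply: eq_bigr => j _; rewrite !linearZ /= sE.
Qed.
End FreeModule.

(** * Free algebras *)

Section FreeAlgebraFacts.
Context (k : fieldType) (N : nat).
Local Notation R := (free_alg k N).

Lemma free_alg_ind (P : R -> Prop) :
  (forall c : k, P c%:A) -> (forall p q, P p -> P q -> P (p + q)) ->
  (forall i p, P p -> P (gen k i * p)) -> forall p, P p.
Proof.
move=> Pc Pa Pm p; rewrite [p]monalgE; apply: (big_ind P) => //.
  by have := Pc 0; rewrite scale0r.
move=> [s] _; move: (p@_ _) => c {p}; elim: s => [|i s /Pm-/(_ i)].
  by have := Pc c; rewrite -mul_malgC mulr1 /= [mone]fmoneE.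
by rewrite /gen malgM_def fgmulUU mul1r /mmul /= fmmulE fmuE.
Qed.

Lemma free_alg_rmorph_eq (S : pzRingType) (f g : {rmorphism R -> S}) :
  (forall c : k, f c%:A = g c%:A) -> (forall i, f (gen k i) = g (gen k i)) ->
  f =1 g.
Proof.
move=> fgk fgx; apply: free_alg_ind => // [p q|i p] fp.
  by rewrite !rmorphD fp => ->.
by rewrite !rmorphM fp fgx.
Qed.

Lemma scalar_comm (c : k) (p : R) : c%:A * p = p * c%:A.
Proof.
elim/free_alg_ind: p => [d|p q IHp IHq|i p IHp].
- by rewrite -!scalerAl !mul1r !scalerA mulrC.
- by rewrite mulrDl mulrDr IHp IHq.
- rewrite -mulrA -IHp !mulrA; congr (_ * _).
  apply/malgP => w; rewrite -scalerAl mul1r mcoeffZ /gen -[c%:A]mul_malgC mulr1.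
  by rewrite malgM_def fgmulUU mul1r mulm1 !mcoeffU mulrnAr mulr1.
Qed.

Lemma mcoeff_genM_cons (i j : 'I_N) (p : R) s :
  (gen k i * p)@_(FMonom (j :: s)) = (i == j)%:R * p@_(FMonom s).
Proof.
rewrite /gen malgM_def fgmulUg raddf_sum /=.
under eq_bigr => w _.
  rewrite mul1r mcoeffU fmP /mmul /= fmmulE fmuE /= eqseq_cons.
  over.
have [ij|ij] := eqVneq i j; last by rewrite big1 ?mul0r.
rewrite mul1r [in RHS](monalgE p) raddf_sum /=.
by apply: eq_bigr => w _; rewrite mcoeffU fmP.
Qed.

Lemma const_coef_genM (i : 'I_N) (p : R) : const_coef (gen k i * p) = 0.
Proof.
rewrite /const_coef rmorphM /= /gen mcoeffU.
case: eqP => [/eqP|]; last by rewrite mul0r.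
by rewrite fm1_eq1.
Qed.

Lemma mcoeff_bounded (p : R) :
  exists d, forall s, (d <= size s)%N -> p@_(FMonom s) = 0.
Proof.
exists (mmeasure (@fdeg 'I_N) p) => s le; apply/eqP; rewrite mcoeff_eq0.
exact: (@mmeasure_mnm_ge _ _ (@fdeg 'I_N) p (FMonom s) le).
Qed.

(** The universal property of the free algebra over k, for targets that may be
    the zero ring and in which k need not be central: it is enough that the
    scalars commute with the chosen values. *)
Lemma free_alg_eval (S : pzRingType) (a : {rmorphism k -> S}) (b : 'I_N -> S) :
  (forall c i, a c * b i = b i * a c) ->
  exists f : {rmorphism R -> S},
    (forall c, f c%:A = a c) /\ forall i, f (gen k i) = b i.
Proof.
move=> ab; pose h (w : {fmonom 'I_N}) : S := \prod_(i <- (w : seq 'I_N)) b i.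
have h1 : h mone = 1 by rewrite /h /mone /= fmoneE big_nil.
have hM v w : h (mmul v w) = h v * h w by rewrite /h /mmul /= fmmulE big_cat.
have ah c w : a c * h w = h w * a c.
  rewrite /h; elim: (w : seq _) => [|i s IH].
    by rewrite big_nil mulr1 mul1r.
  by rewrite big_cons mulrA ab -!mulrA IH.
pose f (p : R) : S := \sum_(w <- msupp p) a p@_w * h w.
have fE (d : {fset {fmonom 'I_N}}) p :
    (msupp p `<=` d)%fset -> f p = \sum_(w <- d) a p@_w * h w.
  move=> le; rewrite /f (big_fset_incl _ le) //= => w _ /mcoeff_outdom ->.
  by rewrite rmorph0 mul0r.
have fB : zmod_morphism f.
  move=> p q; rewrite (fE _ _ (msuppB_le p q)).
  rewrite (fE _ p (fsubsetUl _ (msupp q))) (fE _ q (fsubsetUr (msupp p) _)).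
  rewrite -sumrB; apply: eq_bigr => w _.
  by rewrite mcoeffB rmorphB mulrBl.
pose fA : {additive R -> S} := HB.pack f (GRing.isZmodMorphism.Build R S f fB).
have fU c w : fA << c *g w >> = a c * h w.
  by rewrite /fA /= (fE _ _ msuppU_le) big_seq_fset1 mcoeffUU.
have fM : monoid_morphism f.
  split=> [|p q].
    by rewrite -[RHS](mulr1 1) -[X in _ = X * _](rmorph1 a) -h1 -fU.
  rewrite -[LHS]/(fA (p * q)) malgME raddf_sum mulr_suml; apply: eq_bigr => v _.
  rewrite raddf_sum mulr_sumr; apply: eq_bigr => w _.
  by rewrite fU rmorphM hM -!mulrA; congr (_ * _); rewrite !mulrA ah.
pose fR : {rmorphism R -> S} := HB.pack f (GRing.isZmodMorphism.Build R S f fB)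
  (GRing.isMonoidMorphism.Build R S f fM).
exists fR; split=> [c|i].
  by rewrite -mul_malgC mulr1 -[LHS]/(fA _) fU h1 mulr1.
rewrite -[LHS]/(fA _) /gen fU rmorph1 mul1r /h fmuE /=.
by rewrite big_cons big_nil mulr1.
Qed.

Lemma scalar_mx_scale_comm q n t p (D : 'M[k]_(q, n)) (w : 'M[R]_(n, t)) :
  map_mx (in_alg R) D *m (p *: w) = p *: (map_mx (in_alg R) D *m w).
Proof.
apply/matrixP => r z; rewrite !mxE mulr_sumr; apply: eq_bigr => l _.
by rewrite !mxE /= mulrA scalar_comm -mulrA.
Qed.

End FreeAlgebraFacts.

(** * The standard resolution of a finite-dimensional module *)

Section Resolution.
Context (k : fieldType) (N m : nat) (C : 'I_N -> 'M[k]_m).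
Local Notation R := (free_alg k N).
Local Notation scal := (map_mx (in_alg R)).

(** The cokernel of this matrix is the right module k^m on which the i-th
    generator acts by - C i, and the matrix is the standard resolution 0 ->
    k^m (x) R^N -> k^m (x) R -> k^m -> 0 of that module. For m = 1 and C = 0
    it is the row of the generators. *)
Definition resolution_mx : 'M[R]_(m, \sum_(i < N) m) :=
  \mxrow_i ((gen k i)%:M + scal (C i)).

Lemma mul_resolution_mx p (u : 'M[R]_(\sum_(i < N) m, p)) :
  resolution_mx *m u =
  \sum_i (gen k i *: submxcol u i + scal (C i) *m submxcol u i).
Proof.
rewrite -{1}[u]submxcolK mul_mxrow_mxcol; apply: eq_bigr => i _.
by rewrite mulmxDl mul_scalar_mx.
Qed.

(** The leading forms of the columns are y_i e_r, which are right independent.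
    In coefficients, the equation expresses the coefficient of a word s by
    those of the longer words j :: s, and these vanish for long words. *)
Lemma resolution_blocks_inj (v : 'I_N -> 'cV[R]_m) :
  \sum_i (gen k i *: v i + scal (C i) *m v i) = 0 -> forall i, v i = 0.
Proof.
move=> v_eq0.
have vE j s r : (v j r 0)@_(FMonom s) =
    - \sum_i \sum_l C i r l * (v i l 0)@_(FMonom (j :: s)).
  apply/eqP; rewrite -addr_eq0; apply/eqP.
  have /matrixP/(_ r 0)/(congr1 (mcoeff (FMonom (j :: s)))) := v_eq0.
  rewrite mxE mcoeff0 summxE raddf_sum => sum0; rewrite -[RHS]sum0; apply/esym.
  have termE i : ((gen k i *: v i + scal (C i) *m v i) r 0)@_(FMonom (j :: s)) =
      (i == j)%:R * (v i r 0)@_(FMonom s) +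
      \sum_l C i r l * (v i l 0)@_(FMonom (j :: s)).
    rewrite mxE mcoeffD [(gen k i *: v i) r 0]mxE mcoeff_genM_cons.
    congr (_ + _).
    rewrite mxE raddf_sum; apply: eq_bigr => l _.
    by rewrite mxE /= -scalerAl mul1r mcoeffZ.
  rewrite (eq_bigr _ (fun i _ => termE i)).
  rewrite big_split /= (bigD1 j) //= eqxx mul1r [X in _ + X + _]big1 ?addr0 //.
  by move=> i /negPf->; rewrite mul0r.
have [d d0] : exists d, forall s, (d <= size s)%N ->
    forall i r, (v i r 0)@_(FMonom s) = 0.
  have: forall ir : 'I_N * 'I_m, exists d, forall s, (d <= size s)%N ->
      (v ir.1 ir.2 0)@_(FMonom s) = 0 by move=> ir; apply: mcoeff_bounded.
  case/fin_all_exists => d dP; exists (\max_ir d ir) => s le i r.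
  by apply: (dP (i, r)); apply: leq_trans le; apply: leq_bigmax.
have v0 s i r : (v i r 0)@_(FMonom s) = 0.
  have [e] : exists e, (d <= size s + e)%N by exists d; rewrite leq_addl.
  (* Descending induction on the length of s; e measures the distance to d. *)
  elim: e s i r => [|e IH] s i r; first by rewrite addn0 => /d0.
  move=> le; rewrite vE big1 ?oppr0 // => j _; rewrite big1 // => l _.
  by rewrite IH ?mulr0 //= addSnnS.
move=> i; apply/matrixP => r z; rewrite (ord1 z) mxE; apply/malgP => -[s].
by rewrite mcoeff0.
Qed.

Lemma resolution_mx_inj (u : 'cV[R]_(\sum_(i < N) m)) :
  resolution_mx *m u = 0 -> u = 0.
Proof.
rewrite mul_resolution_mx => /resolution_blocks_inj u0.
by rewrite -[u]submxcolK; apply/mxcolP => i; rewrite mxcolK u0 submxcol0.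
Qed.

(** Modulo the image, y_i acts on constant columns as the matrix - C_i, so
    every monomial times a constant column reduces to a constant column. *)
Lemma resolution_mx_span (v : 'cV[R]_m) :
  exists (c : 'cV[k]_m) u, v = scal c + resolution_mx *m u.
Proof.
pose S (v : 'cV[R]_m) :=
  exists (c : 'cV[k]_m) u, v = scal c + resolution_mx *m u.
have SD v1 v2 : S v1 -> S v2 -> S (v1 + v2).
  move=> [c1 [u1 ->]] [c2 [u2 ->]]; exists (c1 + c2), (u1 + u2).
  by rewrite map_mxD mulmxDr addrACA.
have Sp p : forall a : 'cV[k]_m, S (p *: scal a).
  elim/free_alg_ind: p => [c|p q IHp IHq|i p IHp] a.
  - by exists (c *: a), 0; rewrite mulmx0 addr0 map_mxZ.
  - by rewrite scalerDl; apply: SD.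
  (* The i-th block of the resolution matrix sends p a to y_i p a + C_i p a, and
     C_i has scalar entries, hence commutes with p. *)
  - pose u := \mxcol_(j < N) ((j == i)%:R *: (p *: scal a)).
    have -> : (gen k i * p) *: scal a =
        p *: scal (- (C i *m a)) + resolution_mx *m u.
      rewrite mul_resolution_mx (bigD1 i) //=.
      rewrite big1 => [|j /negPf ji]; last first.
        by rewrite mxcolK ji scale0r scaler0 mulmx0 addr0.
      rewrite mxcolK eqxx scale1r addr0 scalerA scalar_mx_scale_comm.
      by rewrite -map_mxM raddfN scalerN addrC addrK.
    by apply: SD => //; exists 0, u; rewrite map_mx0 add0r.
rewrite -/(S v).
have -> : v = \sum_i v i 0 *: scal (delta_mx i 0).
  apply/matrixP => r z; rewrite (ord1 z) summxE (bigD1 r) //= big1 => [|i ir].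
    by rewrite !mxE !eqxx rmorph1 mulr1 addr0.
  by rewrite !mxE eq_sym (negPf ir) rmorph0 mulr0.
apply: (big_ind S) => //; exists 0, 0.
by rewrite map_mx0 mulmx0 addr0.
Qed.

Lemma resolution_mx_Sigma_codim : Sigma_codim (mx_map resolution_mx).
Proof.
split.
- by split; [apply: cV_finitely_generated | apply: cV_projective].
- by split; [apply: cV_finitely_generated | apply: cV_projective].
- move=> u w uw; apply/eqP; rewrite -subr_eq0; apply/eqP.
  apply: resolution_mx_inj; rewrite mulmxBr; apply/eqP; rewrite subr_eq0.
  exact/eqP.
exists m, (@basis_vec R m) => v; have [c [u ->]] := resolution_mx_span v.
exists (fun i => c i 0), u; congr (_ + _).
rewrite (cV_sum_basis (scal c : 'cV[R^c]_m)).
by apply: eq_bigr => i _; rewrite mxE.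
Qed.

End Resolution.

(** * Degree filtration of a free algebra *)

Section LeftDegree.
Context (k : fieldType) (N : nat).
Local Notation R := (free_alg k N).

(** Degree at most d, in a recursive form that exhibits the division of p by
    the generators on the left: this is what a linearization step consumes. *)
Fixpoint deg_le (d : nat) (p : R) : Prop :=
  if d is d'.+1 then
    exists (c : k) (q : 'I_N -> R),
      (forall i, deg_le d' (q i)) /\ p = c%:A + \sum_i gen k i * q i
  else exists c : k, p = c%:A.

Lemma deg_le_scalar d (c : k) : deg_le d c%:A.
Proof.
elim: d c => [|d IH] c; first by exists c.
exists c, (fun _ => 0%:A); split=> //.
by rewrite big1 ?addr0 // => i _; rewrite scale0r mulr0.
Qed.

Lemma deg_le_genM d (i : 'I_N) p : deg_le d p -> deg_le d.+1 (gen k i * p).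
Proof.
move=> dp; exists 0, (fun j => if j == i then p else 0%:A); split=> [j|].
  by case: eqP => // _; apply: deg_le_scalar.
rewrite scale0r add0r (bigD1 i) //= eqxx big1 ?addr0 // => j /negPf->.
exact: mulr0.
Qed.

Lemma deg_leS d p : deg_le d p -> deg_le d.+1 p.
Proof.
elim: d p => [|d IH] p; first by case=> c ->; apply: (@deg_le_scalar 1).
by case=> c [q [dq ->]]; exists c, q; split=> // i; apply/IH/dq.
Qed.

Lemma deg_le_leq d e p : (d <= e)%N -> deg_le d p -> deg_le e p.
Proof.
move=> /subnKC <-; elim: (e - d)%N p => [|m IH] p; first by rewrite addn0.
by rewrite addnS => dp; apply/deg_leS/IH.
Qed.

Lemma deg_leD d p q : deg_le d p -> deg_le d q -> deg_le d (p + q).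
Proof.
elim: d p q => [|d IH] p q.
  by move=> [c ->] [e ->]; exists (c + e); rewrite scalerDl.
move=> [c [f [df ->]]] [e [g [dg ->]]]; exists (c + e), (fun i => f i + g i).
split=> [i|]; first by apply: IH; [apply: df | apply: dg].
rewrite scalerDl addrACA; congr (_ + _); rewrite -big_split /=.
by apply: eq_bigr => i _; rewrite mulrDr.
Qed.

Lemma deg_le_exists p : exists d, deg_le d p.
Proof.
elim/free_alg_ind: p => [c|p q [d dp] [e eq]|i p [d dp]].
- by exists 0; apply: deg_le_scalar.
- exists (maxn d e); apply: deg_leD; apply: deg_le_leq.
  + exact: leq_maxl.
  + by [].
  + exact: leq_maxr.
  + by [].
- by exists d.+1; apply: deg_le_genM.
Qed.

Lemma const_coef_scalar (c : k) : const_coef (c%:A : R) = c.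
Proof. by rewrite /const_coef mcoeffZ mcoeff1 eqxx mulr1. Qed.

Lemma const_coef_decomp (c : k) (q : 'I_N -> R) :
  const_coef (c%:A + \sum_i gen k i * q i) = c.
Proof.
rewrite /const_coef mcoeffD -/(const_coef c%:A) const_coef_scalar.
rewrite raddf_sum big1 ?addr0 // => i _; exact: const_coef_genM.
Qed.

Lemma mx_deg_decomp m d (M : 'M[R]_m) : (forall i j, deg_le d.+1 (M i j)) ->
  exists C : 'I_N -> 'M[R]_m, (forall i r s, deg_le d (C i r s)) /\
    M = map_mx (in_alg R) (map_mx (@const_coef k N) M) + \sum_i gen k i *: C i.
Proof.
move=> dM; have: forall rs : 'I_m * 'I_m, exists q : 'I_N -> R,
    (forall i, deg_le d (q i)) /\
    M rs.1 rs.2 = (const_coef (M rs.1 rs.2))%:A + \sum_i gen k i * q i.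
  move=> [r s] /=; have [c [q [dq ->]]] := dM r s.
  by exists q; rewrite const_coef_decomp.
case/fin_all_exists => q qP.
exists (fun i => \matrix_(r, s) q (r, s) i); split=> [i r s|].
  by rewrite mxE; apply: (qP (r, s)).1.
apply/matrixP => r s; rewrite [LHS](qP (r, s)).2 !mxE summxE; congr (_ + _).
by apply: eq_bigr => i _; rewrite !mxE.
Qed.

Lemma Sigma_prime_const_unit m (M : 'M[R]_m) :
  Sigma_prime M -> map_mx (@const_coef k N) M \in unitmx.
Proof.
move=> [A0 [B [uA0 B0 ->]]].
have -> // : map_mx (@const_coef k N) (map_mx (fun c => c%:A) A0 + B) = A0.
apply/matrixP => r s; rewrite !mxE -[RHS]addr0 -(B0 r s).
by rewrite /const_coef mcoeffD -/(const_coef _%:A) const_coef_scalar.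
Qed.

End LeftDegree.

(** * Matrices in the inverse variables over a localization at Sigma *)

Lemma mxblock_delta (S : pzRingType) N m :
  \mxblock_(i < N, j < N) ((i == j)%:R%:M : 'M[S]_m) = 1%:M.
Proof.
rewrite -mxdiagZ; apply: eq_mxblock => i j.
by case: eqVneq => _; rewrite ?conform_mx_id // raddf0.
Qed.

Section InverseRow.
Context (k : fieldType) (N : nat) (S : pzRingType).
Local Notation R := (free_alg k N).
Context (mu : {rmorphism R -> S}) (mu_inv : inverting (@Sigma_codim k N) mu).

Lemma resolution_mx_invertible m (C : 'I_N -> 'M[k]_m) :
  mx_invertible (map_mx mu (resolution_mx C)).
Proof.
exact/mx_invertible_of_makes_invertible/mu_inv/resolution_mx_Sigma_codim.
Qed.

Lemma map_resolution_mx m (C : 'I_N -> 'M[k]_m) :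
  map_mx mu (resolution_mx C) =
  \mxrow_i ((mu (gen k i))%:M + map_mx mu (map_mx (in_alg R) (C i))).
Proof.
rewrite /resolution_mx; apply/matrixP => r s.
by rewrite !mxE rmorphD rmorphMn.
Qed.

(** The row of the generators is the resolution of the one-dimensional module
    on which they all act by zero, hence it becomes invertible. *)
Lemma inverse_row_exists : exists x : 'I_N -> S,
  (forall i j, x i * mu (gen k j) = (i == j)%:R) /\
  \sum_i mu (gen k i) * x i = 1.
Proof.
have [X []] := resolution_mx_invertible (fun _ => 0 : 'M[k]_1).
rewrite map_resolution_mx -[X]submxcolK mul_mxrow_mxcol mul_mxcol_mxrow.
rewrite -mxblock_delta => YX XY.
exists (fun i => submxcol X i 0 0); split=> [i j|].
  have /matrixP/(_ 0 0) := (eq_mxblockP _ _).2 XY i j.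
  by rewrite !map_mx0 addr0 mxE big_ord1 !mxE !eqxx.
have /matrixP/(_ 0 0) := YX; rewrite summxE [RHS]mxE eqxx => YX1.
apply: etrans YX1; apply: eq_bigr => i _; apply/esym.
by rewrite !map_mx0 addr0 mxE big_ord1 !mxE !eqxx.
Qed.

Section DualColumn.
Context (x : 'I_N -> S).
Hypotheses (xy : forall i j, x i * mu (gen k j) = (i == j)%:R)
  (yx : \sum_i mu (gen k i) * x i = 1).

(** Scalars commute with the entries of the inverse column because they
    commute with the row (y_j) that it inverts. *)
Lemma dual_eval_exists : exists phi : {rmorphism R -> S},
  (forall c, phi c%:A = mu c%:A) /\ forall i, phi (gen k i) = x i.
Proof.
have [c i|phi [phik phix]] := @free_alg_eval k N S (mu \o in_alg R) x.
  rewrite /=.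
  transitivity (\sum_j x i * mu (gen k j) * mu c%:A * x j).
    rewrite (bigD1 i) //= xy eqxx mul1r big1 ?addr0 // => j.
    by rewrite xy eq_sym => /negPf->; rewrite !mul0r.
  transitivity (x i * mu c%:A * \sum_j mu (gen k j) * x j); last first.
    by rewrite yx mulr1.
  rewrite mulr_sumr; apply: eq_bigr => j _.
  rewrite mulrA; congr (_ * _); rewrite -!mulrA; congr (_ * _).
  by rewrite -!rmorphM scalar_comm.
by exists phi; split.
Qed.

Context (phi : {rmorphism R -> S}).
Hypotheses (phik : forall c, phi c%:A = mu c%:A)
  (phix : forall i, phi (gen k i) = x i).

Lemma dual_col_invertible m :
  mx_invertible (\mxcol_(i < N) ((x i)%:M : 'M[S]_m)).
Proof.
exists (\mxrow_i (mu (gen k i))%:M).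
rewrite mul_mxcol_mxrow mul_mxrow_mxcol -mxblock_delta; split.
  by apply: eq_mxblock => i j; rewrite -scalar_mxM xy.
under eq_bigr => i _ do rewrite -scalar_mxM.
by rewrite -raddf_sum yx.
Qed.

(** As sum_i y_i x_i = 1, the matrix 1 + sum_i x_i C_i factors as the row of
    blocks y_i + C_i times the column of blocks x_i: a resolution, which is in
    Sigma, times an invertible column. *)
Lemma linear_monic_invertible m (C : 'I_N -> 'M[k]_m) :
  mx_invertible (map_mx phi (1%:M + \sum_i gen k i *: map_mx (in_alg R) (C i))).
Proof.
have -> : map_mx phi (1%:M + \sum_i gen k i *: map_mx (in_alg R) (C i)) =
    map_mx mu (resolution_mx C) *m \mxcol_(i < N) (x i)%:M.
  rewrite map_resolution_mx mul_mxrow_mxcol.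
  under [RHS]eq_bigr => i _ do rewrite mulmxDl -scalar_mxM.
  rewrite big_split /= -raddf_sum yx map_mxD map_mx1; congr (_ + _).
  rewrite raddf_sum; apply: eq_bigr => i _ /=.
  apply/matrixP => r s; rewrite !mxE rmorphM phix (bigD1 s) //= big1 => [|l ls].
    rewrite !mxE eqxx addr0 phik -!phix -!phik -!rmorphM; congr (phi _).
    exact/esym/scalar_comm.
  by rewrite !mxE (negPf ls) mulr0.
exact: mx_invertibleM (resolution_mx_invertible C) (dual_col_invertible m).
Qed.

Lemma linear_invertible m (D : 'M[k]_m) (C : 'I_N -> 'M[k]_m) :
  D \in unitmx ->
  mx_invertible (map_mx phi (map_mx (in_alg R) D +
    \sum_i gen k i *: map_mx (in_alg R) (C i))).
Proof.
move=> uD.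
have -> : map_mx (in_alg R) D + \sum_i gen k i *: map_mx (in_alg R) (C i) =
    map_mx (in_alg R) D *m
    (1%:M + \sum_i gen k i *: map_mx (in_alg R) (invmx D *m C i)).
  rewrite mulmxDr mulmx1 mulmx_sumr; congr (_ + _); apply: eq_bigr => i _.
  by rewrite scalar_mx_scale_comm -map_mxM mulKVmx.
rewrite map_mxM; apply: mx_invertibleM (linear_monic_invertible _).
exists (map_mx phi (map_mx (in_alg R) (invmx D))).
have scalK (A B : 'M[k]_m) : A *m B = 1%:M ->
    map_mx phi (map_mx (in_alg R) A) *m map_mx phi (map_mx (in_alg R) B) = 1%:M.
  move=> AB; rewrite -(map_mxM phi) -(map_mxM (in_alg R)) AB.
  by rewrite (map_mx1 (in_alg R)) (map_mx1 phi).
by split; apply: scalK; [apply: mulmxV | apply: mulVmx].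
Qed.

(** Higman linearization. A matrix of degree at most d + 2 is D + X C, where X
    is the row of blocks x_i and C has degree at most d + 1; it is the Schur
    complement of a matrix with blocks 1, C, - X and D, whose degree is at
    most d + 1 and whose constant part is block triangular with determinant
    det D. Degree one is the last case that this can reach, since X is itself
    linear. *)
Lemma deg_le_invertible d m (M : 'M[R]_m) :
  (forall r s, deg_le d.+1 (M r s)) -> map_mx (@const_coef k N) M \in unitmx ->
  mx_invertible (map_mx phi M).
Proof.
elim: d m M => [|d IH] m M dM.
  move=> uD; have [C [dC ->]] := mx_deg_decomp dM.
  have -> : \sum_i gen k i *: C i =
      \sum_i gen k i *: map_mx (in_alg R) (map_mx (@const_coef k N) (C i)).
    apply: eq_bigr => i _; congr (_ *: _); apply/matrixP => r s; rewrite !mxE.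
    by have [c ->] := dC i r s; rewrite const_coef_scalar.
  exact: linear_invertible.
have [C [dC ME]] := mx_deg_decomp dM.
set D := map_mx (@const_coef k N) M in ME *.
move=> uD.
pose X : 'M[R]_(m, \sum_(i < N) m) := \mxrow_i (gen k i)%:M.
have {ME} ME : M = map_mx (in_alg R) D + X *m \mxcol_i C i.
  rewrite {1}ME mul_mxrow_mxcol; congr (_ + _); apply: eq_bigr => i _.
  by rewrite mul_scalar_mx.
rewrite ME map_mxD map_mxM; apply: mx_invertible_schur.
rewrite -map_mxN -(map_mx1 phi) -map_block_mx; apply: IH.
  move=> r s; rewrite mxE.
  case: splitP => r' _; rewrite mxE; case: splitP => s' _.
  - by rewrite mxE -(rmorph_nat (in_alg R)); apply: deg_le_scalar.
  - by rewrite mxE; apply: dC.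
  - rewrite !mxE -mulr_natr -mulrN; apply: deg_le_genM.
    rewrite -(rmorph_nat (in_alg R)) -(rmorphN (in_alg R)).
    exact: deg_le_scalar.
  - by rewrite mxE; apply: deg_le_scalar.
rewrite map_block_mx.
have -> : map_mx (@const_coef k N) (1%:M : 'M_(\sum_(i < N) m)) = 1%:M.
  apply/matrixP => r s; rewrite !mxE -(rmorph_nat (in_alg R)).
  exact: const_coef_scalar.
have -> : map_mx (@const_coef k N) (- X) = 0.
  apply/matrixP => r s; rewrite !mxE -mulr_natr -mulrN; exact: const_coef_genM.
rewrite unitmxE det_ublock det1 mul1r -unitmxE.
have -> : map_mx (@const_coef k N) (map_mx (in_alg R) D) = D; last exact: uD.
by apply/matrixP => r s; rewrite mxE [map_mx _ D r s]mxE const_coef_scalar.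
Qed.

Lemma Sigma_prime_invertible m (M : 'M[R]_m) :
  Sigma_prime M -> mx_invertible (map_mx phi M).
Proof.
move=> /Sigma_prime_const_unit.
have: forall rs : 'I_m * 'I_m, exists d, deg_le d (M rs.1 rs.2).
  by move=> rs; apply: deg_le_exists.
case/fin_all_exists => d dM; apply: (@deg_le_invertible (\max_rs d rs)) => r s.
by apply/deg_leS/deg_le_leq/(dM (r, s)); apply: leq_bigmax.
Qed.

Lemma dual_eval_inverts_Sigma1 : inverting (@Sigma1 k N) phi.
Proof.
move=> P P' alpha [m M /Sigma_prime_invertible|].
  exact: makes_invertible_of_mx_invertible.
apply: makes_invertible_of_mx_invertible.
exists (\row_j mu (gen k j)); split; apply/matrixP => i j.
  by rewrite !mxE big_ord1 !mxE phix xy.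
rewrite (ord1 i) (ord1 j) !mxE eqxx -[RHS]yx; apply: eq_bigr => l _.
by rewrite !mxE phix.
Qed.

End DualColumn.
End InverseRow.

(** * Right actions *)

(** Writing the action on the right keeps the order of the factors the same as
    in the ring, which the scaling by the converse ring reverses. *)
Definition ract (A : pzRingType) (V : rmodType A) (v : V) (a : A) : V :=
  (a : A^c) *: v.
Local Notation "v <* a" := (ract v a) (at level 40, left associativity).

Section RightAction.
Context (A : pzRingType) (V : rmodType A).
Implicit Types (v w : V) (a b : A).

Lemma ractA v a b : v <* a <* b = v <* (a * b).
Proof. exact: scalerA. Qed.

Lemma ract1 v : v <* 1 = v.
Proof. exact: scale1r. Qed.

Lemma ractDl v w a : (v + w) <* a = v <* a + w <* a.
Proof. exact: scalerDr. Qed.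

Lemma ractDr v a b : v <* (a + b) = v <* a + v <* b.
Proof. exact: scalerDl. Qed.

Lemma ractNr v a : v <* (- a) = - (v <* a).
Proof. exact: scaleNr. Qed.

Lemma ract_suml (I : Type) (r : seq I) (P : pred I) (F : I -> V) a :
  (\sum_(i <- r | P i) F i) <* a = \sum_(i <- r | P i) F i <* a.
Proof. exact: scaler_sumr. Qed.

Lemma ract_sumr (I : Type) (r : seq I) (P : pred I) (F : I -> A) v :
  v <* (\sum_(i <- r | P i) F i) = \sum_(i <- r | P i) v <* F i.
Proof. exact: scaler_suml. Qed.

Lemma ract0r v : v <* 0 = 0.
Proof. exact: scale0r. Qed.

Lemma ract_sum_delta (I : finType) (z : I -> V) (a : I -> A) l :
  a l = 1 -> (forall j, j != l -> a j = 0) -> \sum_j z j <* a j = z l.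
Proof.
move=> al a0; rewrite (bigD1 l) //= al ract1 big1 ?addr0 // => j /a0->.
exact: ract0r.
Qed.

Lemma linear_ract (W : rmodType A) (g : {linear V -> W}) v a :
  g (v <* a) = g v <* a.
Proof. exact: linearZZ. Qed.

Definition mx_ract m n (z : 'I_m -> V) (M : 'M[A]_(m, n)) (j : 'I_n) : V :=
  \sum_l z l <* M l j.

Lemma mx_ractA m n p (z : 'I_m -> V) (M : 'M[A]_(m, n)) (W : 'M[A]_(n, p)) :
  mx_ract (mx_ract z M) W =1 mx_ract z (M *m W).
Proof.
move=> i; rewrite /mx_ract; under eq_bigr => j _.
  rewrite ract_suml; under eq_bigr => l _ do rewrite ractA.
  over.
rewrite exchange_big; apply: eq_bigr => l _ /=.
by rewrite -ract_sumr mxE.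
Qed.

Lemma mx_ract1 m (z : 'I_m -> V) : mx_ract z 1%:M =1 z.
Proof.
move=> i; apply: ract_sum_delta => [|l /negPf li]; first by rewrite mxE eqxx.
by rewrite mxE li.
Qed.

Lemma eq_mx_ract m n (z z' : 'I_m -> V) (M : 'M[A]_(m, n)) :
  z =1 z' -> mx_ract z M =1 mx_ract z' M.
Proof. by move=> zz i; apply: eq_bigr => l _; rewrite zz. Qed.

End RightAction.

(** * Bases modulo an image of finite codimension *)

Section BasisModuloImage.
Context (k : fieldType) (N : nat).
Local Notation R := (free_alg k N).
Context (P P' : rmodType R) (alpha : {linear P -> P'}).

Definition spans_mod_image d (v : 'I_d -> P') : Prop :=
  forall p' : P', exists (c : 'I_d -> k) (p : P),
    p' = \sum_i v i <* (c i)%:A + alpha p.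

Definition free_mod_image d (v : 'I_d -> P') : Prop :=
  forall (c : 'I_d -> k) (p : P),
    \sum_i v i <* (c i)%:A = alpha p -> forall i, c i = 0.

Lemma ract_scalar (V : rmodType R) (v : V) (c e : k) :
  v <* c%:A <* e%:A = v <* (c * e)%:A.
Proof. by rewrite ractA -scalerAl mul1r scalerA. Qed.

(** A relation with c i0 <> 0 rewrites v i0 in terms of the other vectors and
    of the image of alpha. *)
Lemma spans_drop d (v : 'I_d.+1 -> P') (c : 'I_d.+1 -> k) p i0 :
  spans_mod_image v -> \sum_i v i <* (c i)%:A = alpha p -> c i0 != 0 ->
  spans_mod_image (fun j => v (lift i0 j)).
Proof.
move=> sv cp c0 p'; have [a [q ->]] := sv p'.
pose t := a i0 / c i0.
exists (fun j => a (lift i0 j) - c (lift i0 j) * t), (q + p <* t%:A).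
rewrite raddfD /= linear_ract -cp ract_suml.
under [X in _ + (_ + X)]eq_bigr => i _ do rewrite ract_scalar.
rewrite [in LHS](bigD1_ord i0) // [X in _ = _ + (_ + X)](bigD1_ord i0) //=.
rewrite {2}/t mulrCA mulfV // mulr1.
under [X in _ = X + _]eq_bigr => j _ do rewrite scalerBl ractDr ractNr.
rewrite big_split /= sumrN.
have regroup (x s w t' : P') : x + s + w = s - t' + (w + (x + t')).
  rewrite [x + t' in RHS]addrC [w + _ in RHS]addrCA [RHS]addrA subrK.
  by rewrite [w + x]addrC addrA [s + x]addrC.
exact: regroup.
Qed.

Lemma basis_mod_image_exists : image_finite_codim alpha ->
  exists d (v : 'I_d -> P'), spans_mod_image v /\ free_mod_image v.
Proof.
case=> d; elim: d => [|d IH] [v sv].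
  by exists 0, v; split=> // c p _ [].
have [fv|nfv] := classic (free_mod_image v); first by exists d.+1, v.
have [c [p [i [cp ci]]]] : exists (c : 'I_d.+1 -> k) (p : P) i,
    \sum_i v i <* (c i)%:A = alpha p /\ c i != 0.
  apply: NNPP => nex; apply: nfv => c p cp i; apply/eqP/negPn/negP => ci.
  by apply: nex; exists c, p, i.
by apply: IH; exists (fun j => v (lift i j)); apply: spans_drop sv cp ci.
Qed.

End BasisModuloImage.

(** * Maps of finite codimension over a localization at Sigma_1 *)

Section InvertsCodim.
Context (k : fieldType) (N : nat) (T : pzRingType).
Local Notation R := (free_alg k N).
Context (lambda : {rmorphism R -> T}).
Hypothesis lambda_inv : inverting (@Sigma1 k N) lambda.
Context (y : 'I_N -> T).
Hypotheses (xy : forall i j, lambda (gen k i) * y j = (i == j)%:R)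
  (yx : \sum_i y i * lambda (gen k i) = 1).
Context (rho : {rmorphism R -> T}).
Hypotheses (rho_alg : forall c : k, rho c%:A = lambda c%:A)
  (rho_gen : forall j, rho (gen k j) = y j).

Section System.
Context (d : nat) (D : 'I_N -> 'M[k]_d).

(** If y_i acts on k^d by D i, then a row z of elements of a T-module is
    compatible with this action when z y_i = z D_i for all i. Multiplying by
    x_i and adding up turns these equations into the single equation z M = 0,
    where M is this matrix. *)
Definition characteristic_mx : 'M[R]_d :=
  1%:M - \sum_i gen k i *: map_mx (in_alg R) (D i).

Lemma characteristic_mx_Sigma_prime : Sigma_prime characteristic_mx.
Proof.
exists 1%:M, (- \sum_i gen k i *: map_mx (in_alg R) (D i)); split.
- exact: unitmx1.
- move=> r s; rewrite mxE summxE /const_coef raddfN raddf_sum.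
  rewrite big1 ?oppr0 // => i _; by rewrite mxE; apply: const_coef_genM.
- by rewrite (map_mx1 (in_alg R)).
Qed.

Context (V : rmodType T).

Definition companion (z : 'I_d -> V) (i : 'I_N) (j : 'I_d) : V :=
  \sum_l z l <* rho (D i l j)%:A.

Lemma mx_ract_characteristic (z : 'I_d -> V) j :
  mx_ract z (map_mx lambda characteristic_mx) j =
  z j - \sum_i companion z i j <* lambda (gen k i).
Proof.
rewrite -[X in X - _](mx_ract1 z j) /mx_ract.
under [X in _ = _ - X]eq_bigr => i _ do rewrite ract_suml.
rewrite exchange_big -sumrB; apply: eq_bigr => l _ /=.
under eq_bigr => i _ do rewrite ractA.
rewrite -ract_sumr -ractNr -ractDr !mxE summxE; congr (_ <* _).
rewrite rmorphB rmorph_nat rmorph_sum; congr (_ - _).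
apply: eq_bigr => i _.
by rewrite !mxE rho_alg -rmorphM scalar_comm.
Qed.

(** Both directions come from the fact that x is inverse to y: summing z y_i =
    z D_i + b_i against x_i uses sum_i y_i x_i = 1, and multiplying the result
    by y_i recovers each equation by x_i y_j = delta_ij. Solving the system
    for given D and b thus amounts to dividing by one square matrix. *)
Lemma systemP (z : 'I_d -> V) (b : 'I_N -> 'I_d -> V) :
  (forall i j, z j <* y i = companion z i j + b i j) <->
  (mx_ract z (map_mx lambda characteristic_mx) =1
   fun j => \sum_i b i j <* lambda (gen k i)).
Proof.
split=> [zE j|zE i j].
  rewrite mx_ract_characteristic -[X in X - _]ract1 -yx ract_sumr -sumrB.
  apply: eq_bigr => i _.
  by rewrite -ractA zE ractDl addrC addKr.
have -> : z j = \sum_i (companion z i j + b i j) <* lambda (gen k i).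
  under eq_bigr => l _ do rewrite ractDl.
  rewrite big_split /= -zE mx_ract_characteristic.
  by rewrite addrCA subrr addr0.
rewrite ract_suml (bigD1 i) //= ractA xy eqxx ract1 big1 ?addr0 // => l li.
by rewrite ractA xy (negPf li); apply: ract0r.
Qed.

Lemma characteristic_mx_invertible :
  mx_invertible (map_mx lambda characteristic_mx).
Proof.
apply/mx_invertible_of_makes_invertible/lambda_inv/Sigma1_square.
exact: characteristic_mx_Sigma_prime.
Qed.

Lemma system_uniq (z z' : 'I_d -> V) (b : 'I_N -> 'I_d -> V) :
  (forall i j, z j <* y i = companion z i j + b i j) ->
  (forall i j, z' j <* y i = companion z' i j + b i j) -> z =1 z'.
Proof.
move=> /systemP zb /systemP z'b j.
have [W [MW _]] := characteristic_mx_invertible.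
rewrite -[LHS]mx_ract1 -[RHS]mx_ract1 -MW -!mx_ractA.
by apply: eq_mx_ract => i; rewrite zb z'b.
Qed.

Lemma system_solvable (b : 'I_N -> 'I_d -> V) : exists z : 'I_d -> V,
  forall i j, z j <* y i = companion z i j + b i j.
Proof.
have [W [_ WM]] := characteristic_mx_invertible.
pose c j := \sum_i b i j <* lambda (gen k i).
by exists (mx_ract c W); apply/systemP => j; rewrite mx_ractA WM mx_ract1.
Qed.

End System.

Section Extension.
Context (P P' : rmodType R) (alpha : {linear P -> P'}).
Hypothesis alpha_inj : injective alpha.
Context (d : nat) (v : 'I_d -> P').
Hypotheses (sv : spans_mod_image alpha v) (fv : free_mod_image alpha v).

(** The action of the generators on the cokernel of alpha, with its lift to
    the target of alpha. *)
Lemma action_exists : exists (D : 'I_N -> 'M[k]_d) (q : 'I_N -> 'I_d -> P),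
  forall i j, v j <* gen k i = \sum_l v l <* (D i l j)%:A + alpha (q i j).
Proof.
have: forall ij : 'I_N * 'I_d, exists cp : ('I_d -> k) * P,
    v ij.2 <* gen k ij.1 = \sum_l v l <* (cp.1 l)%:A + alpha cp.2.
  by move=> ij; have [c [p E]] := sv (v ij.2 <* gen k ij.1); exists (c, p).
case/fin_all_exists => cp cpE.
exists (fun i => \matrix_(l, j) (cp (i, j)).1 l), (fun i j => (cp (i, j)).2).
move=> i j; under [in RHS]eq_bigr => l _ do rewrite mxE.
exact: cpE (i, j).
Qed.

Context (V : rmodType T).

Lemma semilinear_action (D : 'I_N -> 'M[k]_d) (q : 'I_N -> 'I_d -> P)
    (g : P' -> V) :
  (forall i j, v j <* gen k i = \sum_l v l <* (D i l j)%:A + alpha (q i j)) ->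
  semilinear_along rho g ->
  forall i j, g (v j) <* y i = companion D (g \o v) i j + g (alpha (q i j)).
Proof.
move=> vD sg i j; rewrite -rho_gen -[LHS](sg.2 (gen k i)) -/(ract _ _) vD sg.1.
by rewrite (semilinear_sum sg).
Qed.

(** The values of g on a basis modulo the image solve a system that depends
    only on the restriction of g to the image: Hom (coker alpha, V) = 0. *)
Lemma extension_uniq (g1 g2 : P' -> V) :
  semilinear_along rho g1 -> semilinear_along rho g2 ->
  (forall p, g1 (alpha p) = g2 (alpha p)) -> g1 =1 g2.
Proof.
move=> s1 s2 g12; have [D [q vD]] := action_exists.
have g12v : g1 \o v =1 g2 \o v.
  apply: (@system_uniq _ D _ _ _ (fun i j => g1 (alpha (q i j)))) => i j /=.
    exact: semilinear_action.
  by rewrite g12; apply: semilinear_action.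
move=> p'; have [c [p ->]] := sv p'; rewrite s1.1 s2.1 g12; congr (_ + _).
rewrite (semilinear_sum s1) (semilinear_sum s2); apply: eq_bigr => l _.
by congr (_ *: _); apply: g12v.
Qed.

(** The solution z of the same system prescribes the values of an extension of
    h on the basis v, and the equations of the system say that the resulting
    k-linear map respects the action of the generators: Ext^1 (coker alpha, V)
    = 0. *)
Lemma extension_exists (h : P -> V) : semilinear_along rho h ->
  exists g : P' -> V, semilinear_along rho g /\ forall p, g (alpha p) = h p.
Proof.
move=> sh; have [D [q vD]] := action_exists.
have [z zE] := system_solvable D (fun i j => h (q i j)).
(* G is the graph of the extension.  Additivity and stability under the action
   are checked on the graph, and they give its functionality as well. *)
pose G (p' : P') (n : V) := exists (c : 'I_d -> k) (p : P),
  p' = \sum_l v l <* (c l)%:A + alpha p /\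
  n = \sum_l z l <* rho (c l)%:A + h p.
have GD p1 n1 p2 n2 : G p1 n1 -> G p2 n2 -> G (p1 + p2) (n1 + n2).
  move=> [c1 [q1 [-> ->]]] [c2 [q2 [-> ->]]].
  exists (fun l => c1 l + c2 l), (q1 + q2).
  split.
    under [X in _ = X + _]eq_bigr => l _ do rewrite scalerDl ractDr.
    by rewrite big_split raddfD addrACA.
  under [X in _ = X + _]eq_bigr => l _ do rewrite scalerDl rmorphD ractDr.
  by rewrite big_split sh.1 addrACA.
have GZ (e : k) p n : G p n -> G (p <* e%:A) (n <* rho e%:A).
  move=> [c [p0 [-> ->]]]; exists (fun l => c l * e), (p0 <* e%:A); split.
    under [X in _ = X + _]eq_bigr => l _ do rewrite -ract_scalar.
    by rewrite ractDl ract_suml linear_ract.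
  under [X in _ = X + _]eq_bigr => l _ do
    rewrite -scalerA -[_ *: e%:A]mulr_algl rmorphM -ractA.
  by rewrite ractDl ract_suml [h (p0 <* _)](sh.2 _ p0).
have Galpha p : G (alpha p) (h p).
  exists (fun _ => 0), p; rewrite !big1 ?add0r // => l _.
    by rewrite scale0r rmorph0; apply: ract0r.
  by rewrite scale0r; apply: ract0r.
have Gsum (I : Type) (r : seq I) F E :
    (forall l : I, G (F l) (E l)) -> G (\sum_(l <- r) F l) (\sum_(l <- r) E l).
  move=> GF; elim: r => [|l r IH]; last by rewrite !big_cons; apply: GD.
  rewrite !big_nil -(semilinear0 sh) -[X in G X](raddf0 alpha); exact: Galpha.
have Gv l : G (v l) (z l).
  exists (fun j => (j == l)%:R), 0; rewrite raddf0 (semilinear0 sh) !addr0.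
  split; apply/esym; apply: ract_sum_delta => [|j /negPf->].
  - by rewrite eqxx scale1r.
  - by rewrite scale0r.
  - by rewrite eqxx scale1r rmorph1.
  - by rewrite scale0r rmorph0.
have Ggen i p n : G p n -> G (p <* gen k i) (n <* y i).
  move=> [c [p0 [-> ->]]]; rewrite !ractDl !ract_suml -linear_ract.
  apply: (GD); last by rewrite -rho_gen -[h p0 <* _](sh.2 _ p0).
  apply: (Gsum) => l.
  have -> : v l <* (c l)%:A <* gen k i = v l <* gen k i <* (c l)%:A.
    by rewrite !ractA scalar_comm.
  have -> : z l <* rho (c l)%:A <* y i = z l <* y i <* rho (c l)%:A.
    by rewrite !ractA -rho_gen -!rmorphM scalar_comm.
  apply: (GZ); rewrite vD zE; apply: (GD) => //.
  by apply: (Gsum) => l'; apply: (GZ).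
have Gmul a : forall p n, G p n -> G (p <* a) (n <* rho a).
  elim/free_alg_ind: a => [c|a b IHa IHb|i a IHa] p n Gpn.
  - exact: GZ.
  - by rewrite rmorphD !ractDr; apply: (GD); [apply: IHa | apply: IHb].
  - by rewrite rmorphM rho_gen -!ractA; apply/IHa/Ggen.
have Gfun p n1 n2 : G p n1 -> G p n2 -> n1 = n2.
  move=> G1 G2; have := GD _ _ _ _ G1 (GZ (-1) _ _ G2).
  rewrite !scaleN1r rmorphN rmorph1 !ractNr !ract1 subrr.
  case=> c [p0 [E12 n12]].
  have c0 : forall l, c l = 0.
    by apply: (fv (p := - p0)); apply/eqP; rewrite raddfN -addr_eq0 -E12.
  have p00 : p0 = 0.
    apply: alpha_inj; rewrite raddf0 [RHS]E12 big1 ?add0r // => l _.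
    by rewrite c0 scale0r; apply: ract0r.
  apply/eqP; rewrite -subr_eq0 n12 p00 (semilinear0 sh) addr0 big1 // => l _.
  by rewrite c0 scale0r rmorph0; apply: ract0r.
have Gtotal p : exists n, G p n.
  have [c [p0 E]] := sv p; exists (\sum_l z l <* rho (c l)%:A + h p0).
  by exists c, p0.
pose g p := proj1_sig (constructive_indefinite_description _ (Gtotal p)).
have Gg p : G p (g p) by rewrite /g; case: constructive_indefinite_description.
exists g; split; last by move=> p; apply: Gfun (Gg _) (Galpha p).
split=> [p p1|a p]; first by apply: Gfun (Gg _) _; apply: (GD).
by apply: Gfun (Gg _) _; apply: Gmul.
Qed.

End Extension.

Lemma inverts_Sigma_codim : inverting (@Sigma_codim k N) rho.
Proof.
move=> P P' alpha [_ _ ainj /basis_mod_image_exists[d [v [sv fv]]]].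
apply: makes_invertible_of_extension => V.
  by move=> h sh; apply: (extension_exists ainj sv fv sh).
by move=> g1 g2 s1 s2; apply: (extension_uniq sv s1 s2).
Qed.

End InvertsCodim.

(** * The isomorphism *)

Lemma localization_endo_id (A : pzRingType) (S : morphism_set A)
    (AS : pzRingType) (iota : {rmorphism A -> AS}) (h : {rmorphism AS -> AS}) :
  is_universal_localization S iota -> (forall a, h (iota a) = iota a) ->
  h =1 id.
Proof.
move=> [iota_inv univ] hK; have [g [_ gE]] := univ AS iota iota_inv.
by move=> x; rewrite (gE h hK) -(gE idfun).
Qed.

Lemma inverse_col_uniq (S : pzRingType) (N : nat) (x x' y : 'I_N -> S) :
  (forall i j, x' i * y j = (i == j)%:R) -> \sum_j y j * x j = 1 -> x =1 x'.
Proof.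
move=> x'y yx i; rewrite -[RHS]mulr1 -yx mulr_sumr (bigD1 i) //= mulrA x'y eqxx.
rewrite mul1r big1 ?addr0 // => j; rewrite eq_sym => /negPf ij.
by rewrite mulrA x'y ij mul0r.
Qed.

Lemma inverse_row_uniq (S : pzRingType) (N : nat) (x y y' : 'I_N -> S) :
  (forall i j, x i * y' j = (i == j)%:R) -> \sum_j y j * x j = 1 -> y =1 y'.
Proof.
move=> xy' yx j; rewrite -[RHS]mul1r -yx mulr_suml (bigD1 j) //= -mulrA xy'.
rewrite eqxx mulr1 big1 ?addr0 // => i /negPf ij.
by rewrite -mulrA xy' ij mulr0.
Qed.

Theorem theorem7p5 (k : fieldType) (n : nat) (n_gt0 : (0 < n)%N)
    (T : pzRingType) (lambda : {rmorphism free_alg k n.+1 -> T})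
    (T_loc : is_universal_localization (@Sigma1 k n.+1) lambda)
    (y : 'I_n.+1 -> T)
    (xy : forall i j : 'I_n.+1, lambda (gen k i) * y j = (i == j)%:R)
    (yx : \sum_(i < n.+1) y i * lambda (gen k i) = 1)
    (rho : {rmorphism free_alg k n.+1 -> T})
    (rho_alg : forall c : k, rho c%:A = lambda c%:A)
    (rho_gen : forall j : 'I_n.+1, rho (gen k j) = y j)
    (Q : pzRingType) (mu : {rmorphism free_alg k n.+1 -> Q})
    (Q_loc : is_universal_localization (@Sigma_codim k n.+1) mu) :
  exists psi : {rmorphism Q -> T},
    [/\ bijective psi,
        forall c : k, psi (mu c%:A) = lambda c%:A
      & forall r : free_alg k n.+1, psi (mu r) = rho r] /\
    forall psi' : {rmorphism Q -> T},
      [/\ bijective psi',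
          forall c : k, psi' (mu c%:A) = lambda c%:A
        & forall r : free_alg k n.+1, psi' (mu r) = rho r] ->
      psi' =1 psi.
Proof.
have rho_inv := inverts_Sigma_codim T_loc.1 xy yx rho_alg rho_gen.
have [psi [psiE psi_uniq]] := Q_loc.2 T rho rho_inv.
have [x [xmu mux]] := inverse_row_exists Q_loc.1.
have [phi [phik phix]] := dual_eval_exists xmu mux.
have phi_inv := dual_eval_inverts_Sigma1 Q_loc.1 xmu mux phik phix.
have [chi [chiE _]] := T_loc.2 Q phi phi_inv.
exists psi; split=> [|psi' [_ _ psi'E]]; last exact: psi_uniq psi'E.
have psix : psi \o x =1 (lambda \o @gen k n.+1).
  apply: (inverse_col_uniq (y := y)) => //=.
  rewrite -[RHS](rmorph1 psi) -mux rmorph_sum; apply: eq_bigr => j _.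
  by rewrite rmorphM psiE rho_gen.
have chiy : chi \o y =1 (mu \o @gen k n.+1).
  move=> j; apply/esym/(inverse_row_uniq (x := x)) => //= i l.
  by rewrite -phix -chiE -rmorphM xy rmorph_nat.
split=> [|c|//]; last by rewrite psiE rho_alg.
exists chi.
  apply: (localization_endo_id Q_loc (h := chi \o psi)) => r /=; rewrite psiE.
  apply: (free_alg_rmorph_eq (f := chi \o rho) (g := mu)) r => [c|i] /=.
    by rewrite rho_alg chiE phik.
  by rewrite rho_gen; apply: chiy.
apply: (localization_endo_id T_loc (h := psi \o chi)) => a /=; rewrite chiE.
apply: (free_alg_rmorph_eq (f := psi \o phi) (g := lambda)) a => [c|i] /=.
  by rewrite phik psiE rho_alg.
by rewrite phix; apply: psix.
Qed.
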